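(* Let $d$ be a positive integer. Then the balancedness threshold of $d$ satisfies $BT(d)\leq \lceil \log_2 d\rceil$.
   Context: Here $\mathbb{N}=\{0,1,2,\ldots\}$. A sequence $\mathbf{u}=u_0u_1u_2\cdots$ over a finite alphabet $\mathcal{A}$ is an infinite sequence (indexed by $\mathbb{N}$) of letters of $\mathcal{A}$; a $d$-ary sequence is a sequence over an alphabet of size $d$, taken to be $\mathcal{A}=\{1,2,\ldots,d\}$. The frequency of a letter $a$ in $\mathbf{u}$ is the limit (if it exists) $f_a=\lim_{n\to\infty}\frac{\#\{i<n:\ u_i=a\}}{n}$; if all letters have well-defined frequencies, the frequency vector of $\mathbf{u}$ is $(f_a)_{a\in\mathcal{A}}$. A word $w$ is a factor of $\mathbf{u}$ if $w=u_iu_{i+1}\cdots u_{i+|w|-1}$ for some $i\in\mathbb{N}$, where $|w|$ is the length of $w$; $|w|_a$ denotes the number of occurrences of the letter $a$ in $w$. For $k\in\mathbb{N}$, $\mathbf{u}$ is $k$-balanced if for any two factors $v,w$ of $\mathbf{u}$ of the same length and any letter $a\in\mathcal{A}$ one has $\bigl||v|_a-|w|_a\bigr|\leq k$. We say that $k\in\mathbb{N}$ is frequency restrictive for $d$ if there exists a positive vector $\vec f=(f_1,\ldots,f_d)$ (all entries positive reals) with $\sum_{i=1}^d f_i=1$ such that no $k$-balanced $d$-ary sequence has the frequency vector $\vec f$. The balancedness threshold $BT(d)$ is the minimum $k\in\mathbb{N}$ such that $k$ is not frequency restrictive for $d$. *)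

(* Defs.v *)
From HB Require Import structures.
From mathcomp Require Import all_boot all_order all_algebra.
From mathcomp Require Import all_classical all_reals all_analysis.

Set Implicit Arguments.
Unset Strict Implicit.
Unset Printing Implicit Defensive.

Import Order.TTheory GRing.Theory Num.Theory.
Import numFieldNormedType.Exports.

Local Open Scope classical_set_scope.
Local Open Scope ring_scope.

(** The alphabet {1, ..., d} is encoded as ['I_d]; a d-ary sequence is a
    function [nat -> 'I_d], and a word is a [seq 'I_d], in which the letter [a]
    occurs [count_mem a w] times. *)

Definition factor (d : nat) (u : nat -> 'I_d) (w : seq 'I_d) : Prop :=
  exists i : nat, w = [seq u j | j <- iota i (size w)].

Definition balanced (d k : nat) (u : nat -> 'I_d) : Prop :=
  forall (v w : seq 'I_d) (a : 'I_d),
    factor u v -> factor u w -> size v = size w ->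
    (`|(count_mem a v)%:Z - (count_mem a w)%:Z| <= k%:Z)%R.

(** The value at [n = 0] is [0 / 0 = 0], which is irrelevant to the limit. *)
Definition prefix_frequency (R : realType) (d : nat) (u : nat -> 'I_d)
    (a : 'I_d) (n : nat) : R :=
  #|[pred i : 'I_n | u i == a]|%:R / n%:R.

Definition has_frequency_vector (R : realType) (d : nat) (u : nat -> 'I_d)
    (f : 'I_d -> R) : Prop :=
  forall a : 'I_d, prefix_frequency R u a n @[n --> \oo] --> f a.

Definition frequency_restrictive (R : realType) (d k : nat) : Prop :=
  exists f : 'I_d -> R,
    [/\ forall a, 0 < f a,
        \sum_(a < d) f a = 1 &
        ~ exists u : nat -> 'I_d, balanced k u /\ has_frequency_vector u f].

(** The threshold is a minimum over [nat], whose existence is not known a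
    priori, so "BT(d) = k" is rendered as a relation; it determines [k]. *)
Definition is_BT (R : realType) (d k : nat) : Prop :=
  ~ frequency_restrictive R d k /\
  forall j : nat, ~ frequency_restrictive R d j -> (k <= j)%N.

Lemma is_BT_unique (R : realType) (d k l : nat) :
  is_BT R d k -> is_BT R d l -> k = l.
Proof.
by move=> [hk mk] [hl ml]; apply/eqP; rewrite eqn_leq mk // ml.
Qed.

Definition log2 (R : realType) (x : R) : R := ln x / ln 2.

(* Main.v *)
Require Import Defs.
From HB Require Import structures.
From mathcomp Require Import all_boot all_order all_algebra.
From mathcomp Require Import all_classical all_reals all_analysis.
From mathcomp Require Import zify ring lra.

(** For [k = ceil (log2 d)] the alphabet has at most [2 ^ k] letters, and every
    positive frequency vector on such an alphabet is realised by a [k]-balanced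
    sequence, by induction on [k].  Unless the alphabet has at most [2 ^ k.-1]
    letters already, cut it into two nonempty halves of at most [2 ^ k.-1]
    letters each, of total weights [S1] and [S2], and realise the (renormalised)
    weights of each half by a [k.-1]-balanced sequence.  Interleave these two
    sequences: the first one is read along the positions at which the Sturmian
    counting function [n |-> floor (n * S1 / (S1 + S2))] increases, the second
    one along the others ([interleave]).

    Everything is expressed by the counting functions [occ u a n], the number of
    occurrences of [a] among the first [n] letters.  In an interleaving, the
    counting function of a letter is its counting function in its own half,
    composed with the counting function of the positions of that half.  The
    latter is [1]-balanced, so two windows of the same length contain numbers of
    letters of that half which differ by at most one, and that costs at most
    one additional unit of imbalance ([balanced_fun_comp]): the balance
    constants add up to the number of halvings.

    Frequencies are carried through the induction as bounded distance from a
    linear function ([linear_within_bound]), a property which is stable under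
    composition, the slopes being multiplied, and which implies convergence of
    the prefix frequencies. *)

Set Implicit Arguments.
Unset Strict Implicit.
Unset Printing Implicit Defensive.

Import Order.TTheory GRing.Theory Num.Theory.
Import numFieldNormedType.Exports.
Local Open Scope classical_set_scope.
Local Open Scope ring_scope.

(** * Balanced counting functions *)

(** A window of length [L] sees [g (i + L) - g i]; the subtraction is moved to
    the other side in order to stay in [nat]. *)
Definition balanced_fun (k : nat) (g : nat -> nat) : Prop :=
  forall i j L, (g (i + L) + g j <= g (j + L) + g i + k)%N.

Lemma balanced_fun_leq (k l : nat) (g : nat -> nat) :
  (k <= l)%N -> balanced_fun k g -> balanced_fun l g.
Proof. by move=> kl gk i j L; have := gk i j L; lia. Qed.

(** The increments [p], [q] of [h] over two windows of the same length satisfy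
    [p <= q + 1]; the extra step changes [g] by at most one, and windows of the
    common length [q] are compared by the balance of [g]. *)
Lemma balanced_fun_comp (k : nat) (g h : nat -> nat) :
  {homo h : m n / (m <= n)%N} ->
  (forall n, (g n <= g n.+1 <= (g n).+1)%N) ->
  balanced_fun 1 h -> balanced_fun k g -> balanced_fun k.+1 (g \o h).
Proof.
move=> h_mono g_step h1 gk i j L /=.
have g_mono : {homo g : m n / (m <= n)%N}.
  by apply: homo_leq => // [? ? ?|n]; [exact: leq_trans | case/andP: (g_step n)].
have hiL : (h i <= h (i + L))%N by apply: h_mono; lia.
have hjL : (h j <= h (j + L))%N by apply: h_mono; lia.
have hij := h1 i j L.
set q := (h (j + L) - h j)%N.
have le1 : (g (h (i + L)) <= g (h i + q).+1)%N by apply: g_mono; rewrite /q; lia.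
have /andP[_ le2] := g_step (h i + q)%N.
have := gk (h i) (h j) q; rewrite {2}/q subnKC //; lia.
Qed.

(** * Counting functions with a slope *)

Definition linear_within_bound (R : realType) (g : nat -> nat) (phi : R) : Prop :=
  exists B : R, forall n, `|(g n)%:R - n%:R * phi| <= B.

Lemma linear_within_bound_comp (R : realType) (g h : nat -> nat) (phi psi : R) :
  linear_within_bound g phi -> linear_within_bound h psi ->
  linear_within_bound (g \o h) (psi * phi).
Proof.
move=> [B gB] [B' hB']; exists (B + B' * `|phi|) => n /=.
have -> : (g (h n))%:R - n%:R * (psi * phi) =
  ((g (h n))%:R - (h n)%:R * phi) + ((h n)%:R - n%:R * psi) * phi by ring.
by rewrite (le_trans (ler_normD _ _)) // lerD // normrM ler_wpM2r.
Qed.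

Lemma linear_within_bound_cvg (R : realType) (g : nat -> nat) (phi : R) :
  linear_within_bound g phi -> ((g n)%:R / n%:R : R) @[n --> \oo] --> phi.
Proof.
move=> [B gB].
have B0 : 0 <= B := le_trans (normr_ge0 _) (gB 0%N).
apply/cvgrPdist_le => e e0.
near=> n.
have n0 : 0 < n%:R :> R by rewrite ltr0n; near: n; exists 1%N.
have -> : phi - (g n)%:R / n%:R = - ((g n)%:R - n%:R * phi) / n%:R.
  by field; rewrite gt_eqF.
rewrite normrM normrN normfV (gtr0_norm n0) ler_pdivrMr // (le_trans (gB n)) //.
rewrite mulrC -ler_pdivrMr //.
near: n; exists (Num.truncn (B / e)).+1 => // n /= len.
by rewrite (le_trans (ltW (truncnS_gt _))) // ler_nat.
Unshelve. all: by end_near. Qed.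

(** * The Sturmian counting function *)

Definition sturm (R : realType) (F : R) (n : nat) : nat := Num.truncn (n%:R * F).

Section Sturm.
Variables (R : realType) (F : R).
Hypotheses (F0 : 0 <= F) (F1 : F <= 1).

Let N := sturm F.

Let N_bounds n : (N n)%:R <= n%:R * F < (N n).+1%:R.
Proof. by rewrite /N /sturm truncn_le ?truncnS_gt // mulr_ge0. Qed.

Let N_addn m n : (N m + N n <= N (m + n) <= (N m + N n).+1)%N.
Proof.
have /andP[m1 m2] := N_bounds m; have /andP[n1 n2] := N_bounds n.
have /andP[s1 s2] := N_bounds (m + n).
rewrite -natr1 in m2; rewrite -natr1 in n2.
rewrite natrD mulrDl in s1; rewrite -natr1 natrD mulrDl in s2.
by apply/andP; split; rewrite -ltnS -(ltr_nat R) -!natr1 ?natrD; lra.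
Qed.

Lemma sturm_step n : (N n <= N n.+1 <= (N n).+1)%N.
Proof.
have /andP[n1 n2] := N_bounds n; have /andP[s1 s2] := N_bounds n.+1.
rewrite -natr1 in n2; rewrite -natr1 mulrDl mul1r in s1.
rewrite -!natr1 mulrDl mul1r in s2.
have f0 := F0; have f1 := F1.
by apply/andP; split; rewrite -ltnS -(ltr_nat R) -!natr1; lra.
Qed.

Lemma sturm_le n : (N n <= n)%N.
Proof.
have /andP[n1 _] := N_bounds n.
by rewrite -(ler_nat R) (le_trans n1) // ler_piMr.
Qed.

Lemma sturm_mono : {homo N : m n / (m <= n)%N}.
Proof.
by apply: homo_leq => // [? ? ?|n]; [exact: leq_trans | case/andP: (sturm_step n)].
Qed.

Lemma sturmC_mono : {homo (fun n => n - N n)%N : m n / (m <= n)%N}.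
Proof.
apply: homo_leq => // [? ? ?|n]; first exact: leq_trans.
by have := sturm_step n; have := sturm_le n; lia.
Qed.

(** Both windows are compared with the window starting at [0], using that the
    floor function is additive up to one and superadditive. *)
Lemma balanced_sturm : balanced_fun 1 N.
Proof. by move=> i j L; have := N_addn i L; have := N_addn j L; lia. Qed.

Lemma balanced_sturmC : balanced_fun 1 (fun n => n - N n)%N.
Proof.
move=> i j L; have := balanced_sturm j i L.
have := sturm_le i; have := sturm_le j.
by have := sturm_le (i + L); have := sturm_le (j + L); lia.
Qed.

Lemma linear_sturm : linear_within_bound N F.
Proof.
exists 1 => n; have /andP[n1 n2] := N_bounds n.
by rewrite -natr1 in n2; rewrite ler_norml; apply/andP; split; lra.
Qed.

Lemma linear_sturmC : linear_within_bound (fun n => n - N n)%N (1 - F).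
Proof.
have [B NB] := linear_sturm; exists B => n.
rewrite natrB ?sturm_le // -normrN.
by have -> : - (n%:R - (N n)%:R - n%:R * (1 - F)) = (N n)%:R - n%:R * F by ring.
Qed.

End Sturm.

(** * Occurrences of letters, and interleaving *)

Definition occ (T : eqType) (u : nat -> T) (a : T) (n : nat) : nat :=
  \sum_(i < n) (u i == a).

Lemma occS (T : eqType) (u : nat -> T) (a : T) n :
  occ u a n.+1 = (occ u a n + (u n == a))%N.
Proof. by rewrite /occ big_ord_recr. Qed.

Lemma occ_step (T : eqType) (u : nat -> T) (a : T) n :
  (occ u a n <= occ u a n.+1 <= (occ u a n).+1)%N.
Proof. by rewrite occS; case: (u n == a); lia. Qed.

Lemma occ_notin (T : eqType) (u : nat -> T) (s : seq T) (a : T) n :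
  (forall i, u i \in s) -> a \notin s -> occ u a n = 0%N.
Proof.
move=> us as_; rewrite /occ big1 // => i _; apply/eqP; rewrite eqb0.
by apply: contraNneq as_ => <-.
Qed.

Lemma occ_count (T : eqType) (u : nat -> T) (a : T) i n :
  occ u a (i + n) = (occ u a i + count_mem a [seq u j | j <- iota i n])%N.
Proof.
elim: n i => [|n IHn] i; first by rewrite addn0 addn0.
by rewrite -addSnnS IHn occS /= addnA.
Qed.

Lemma balanced_occ (d k : nat) (u : nat -> 'I_d) :
  (forall a, balanced_fun k (occ u a)) -> balanced k u.
Proof.
move=> uk v w a [i ->] [j ->]; rewrite !size_map !size_iota => <-.
have := uk a i j (size v); have := uk a j i (size v).
rewrite !occ_count.
move: (count_mem a _) (count_mem a _) (occ u a i) (occ u a j) => p q x y; lia.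
Qed.

Lemma prefix_frequency_occ (R : realType) (d : nat) (u : nat -> 'I_d) a n :
  prefix_frequency R u a n = (occ u a n)%:R / n%:R.
Proof.
by rewrite /prefix_frequency /occ -sum1_card big_mkcond; congr (_%:R / _).
Qed.

Definition interleave (T : Type) (N : nat -> nat) (u v : nat -> T) (n : nat) : T :=
  if (N n < N n.+1)%N then u (N n) else v (n - N n)%N.

Lemma occ_interleave (T : eqType) (N : nat -> nat) (u v : nat -> T) (a : T) n :
  (forall n, N n <= N n.+1 <= (N n).+1)%N -> (forall n, N n <= n)%N ->
  occ (interleave N u v) a n = (occ u a (N n) + occ v a (n - N n))%N.
Proof.
move=> N_step N_le; elim: n => [|n IHn].
  by have := N_le 0%N; rewrite leqn0 => /eqP->; rewrite /occ !big_ord0.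
rewrite occS IHn /interleave.
have := N_step n; have Nn := N_le n.
case: ltnP => [lt /andP[_ le]|ge /andP[le _]].
  have -> : N n.+1 = (N n).+1 by lia.
  by rewrite occS subSS addnAC.
have -> : N n.+1 = N n by lia.
by rewrite subSn // occS addnA.
Qed.

(** * Realising frequencies by repeated halving *)

(** A sequence over the alphabet [s] in which the frequency of [a] is
    proportional to the weight [f a]. *)
Definition realises (R : realType) (T : eqType) (k : nat) (s : seq T)
    (f : T -> R) (u : nat -> T) : Prop :=
  [/\ forall n, u n \in s,
      forall a, balanced_fun k (occ u a) &
      forall a, a \in s ->
        linear_within_bound (occ u a) (f a / \sum_(b <- s) f b)].

(** The duplicate-freeness of [s1 ++ s2] makes one of the two terms of
    [occ_interleave] vanish for each letter. *)
Lemma realises_interleave (R : realType) (T : eqType) (k : nat) (s1 s2 : seq T)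
    (f : T -> R) (u1 u2 : nat -> T) :
  uniq (s1 ++ s2) ->
  0 < \sum_(b <- s1) f b -> 0 < \sum_(b <- s2) f b ->
  realises k s1 f u1 -> realises k s2 f u2 ->
  exists u, realises k.+1 (s1 ++ s2) f u.
Proof.
rewrite cat_uniq => /and3P[_ /hasPn s12 _].
set S1 := \sum_(b <- s1) f b; set S2 := \sum_(b <- s2) f b => S1_gt0 S2_gt0.
move=> [us1 bal1 lin1] [us2 bal2 lin2].
have S_gt0 : 0 < S1 + S2 by rewrite addr_gt0.
pose F := S1 / (S1 + S2).
have F0 : 0 <= F by rewrite divr_ge0 // ltW.
have F1 : F <= 1 by rewrite ler_pdivrMr // mul1r lerDl ltW.
pose N := sturm F; pose u := interleave N u1 u2.
have occE a n : occ u a n = (occ u1 a (N n) + occ u2 a (n - N n))%N.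
  by apply: occ_interleave => m; [exact: sturm_step | exact: sturm_le].
have occ1 a : a \notin s2 -> occ u a = occ u1 a \o N.
  by move=> as2; apply/funext => n /=; rewrite occE (occ_notin _ us2 as2) addn0.
have occ2 a : a \notin s1 -> occ u a = occ u2 a \o (fun n => n - N n)%N.
  by move=> as1; apply/funext => n /=; rewrite occE (occ_notin _ us1 as1).
exists u; split.
- move=> n; rewrite mem_cat /u /interleave.
  by case: ifP => _; rewrite ?us1 ?us2 ?orbT.
- move=> a; have [as2|as2] := boolP (a \in s2).
    rewrite (occ2 _ (s12 a as2)); apply: balanced_fun_comp => //.
    + exact: sturmC_mono.
    + exact: occ_step.
    + exact: balanced_sturmC.
  rewrite (occ1 _ as2); apply: balanced_fun_comp => //.
  + exact: sturm_mono.
  + exact: occ_step.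
  + exact: balanced_sturm.
- move=> a; rewrite mem_cat big_cat /= -/S1 -/S2.
  have [as2 _|as2] := boolP (a \in s2).
    have -> : f a / (S1 + S2) = (1 - F) * (f a / S2).
      by rewrite /F; field; rewrite !gt_eqF.
    rewrite (occ2 _ (s12 a as2)); apply: linear_within_bound_comp (lin2 a as2) _.
    exact: linear_sturmC.
  rewrite orbF => as1.
  have -> : f a / (S1 + S2) = F * (f a / S1) by rewrite /F; field; rewrite !gt_eqF.
  rewrite (occ1 _ as2); apply: linear_within_bound_comp (lin1 a as1) _.
  exact: linear_sturm.
Qed.

Lemma sum_seq_gt0 (R : realType) (T : eqType) (s : seq T) (f : T -> R) :
  (0 < size s)%N -> {in s, forall a, 0 < f a} -> 0 < \sum_(a <- s) f a.
Proof.
case: s => // x s _ f_gt0; rewrite big_cons ltr_pwDl ?f_gt0 ?mem_head //.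
by rewrite big_seq sumr_ge0 // => a as_; rewrite ltW // f_gt0 // inE as_ orbT.
Qed.

Lemma realises_exists (R : realType) (T : eqType) (k : nat) (s : seq T)
    (f : T -> R) :
  uniq s -> (0 < size s <= 2 ^ k)%N -> {in s, forall a, 0 < f a} ->
  exists u, realises k s f u.
Proof.
elim: k s => [|k IHk] s s_uniq /andP[s_gt0 s_le] f_gt0.
  case: s s_uniq s_gt0 s_le f_gt0 => [|x [|y s]] // _ _ _ f_gt0.
  have occx n : occ (fun=> x) x n = n.
    by rewrite /occ eqxx sum1_card card_ord.
  exists (fun=> x); split=> [n|a|a]; first by rewrite mem_head.
    have [<-|xa] := eqVneq x a; first by move=> i j L; rewrite !occx; lia.
    have xs (i : nat) : (fun=> x) i \in [:: x] by rewrite mem_head.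
    have ax : a \notin [:: x] by rewrite inE eq_sym.
    by move=> i j L; rewrite !(occ_notin _ xs ax).
  rewrite inE => /eqP->; rewrite big_seq1; exists 0 => n.
  by rewrite occx divff ?gt_eqF ?f_gt0 ?mem_head // mulr1 subrr normr0.
have [small|big] := leqP (size s) (2 ^ k).
  have [|u [us ubal ulin]] := IHk s s_uniq _ f_gt0; first by rewrite s_gt0.
  by exists u; split=> // a; apply: balanced_fun_leq (ubal a).
have s_cat := cat_take_drop (2 ^ k) s.
have f1_gt0 : {in take (2 ^ k) s, forall a, 0 < f a}.
  by move=> a /mem_take; apply: f_gt0.
have f2_gt0 : {in drop (2 ^ k) s, forall a, 0 < f a}.
  by move=> a /mem_drop; apply: f_gt0.
have size1 : (0 < size (take (2 ^ k) s) <= 2 ^ k)%N.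
  by rewrite size_take big expn_gt0 /=.
have size2 : (0 < size (drop (2 ^ k) s) <= 2 ^ k)%N.
  by rewrite size_drop; rewrite expnS in s_le; lia.
have [u1 hu1] := IHk _ (take_uniq _ s_uniq) size1 f1_gt0.
have [u2 hu2] := IHk _ (drop_uniq _ s_uniq) size2 f2_gt0.
rewrite -s_cat; apply: realises_interleave hu1 hu2; rewrite ?s_cat //.
- by apply: sum_seq_gt0 => //; case/andP: size1.
- by apply: sum_seq_gt0 => //; case/andP: size2.
Qed.

(** * The threshold *)

Lemma not_frequency_restrictive (R : realType) (d k : nat) :
  (0 < d <= 2 ^ k)%N -> ~ frequency_restrictive R d k.
Proof.
move=> dk [f [f_gt0 f_sum]]; apply.
have [|//|u [_ ubal ulin]] :=
  @realises_exists R 'I_d k (enum 'I_d) f (enum_uniq _).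
  by rewrite size_enum_ord.
exists u; split; first exact: balanced_occ.
move=> a; under eq_fun do rewrite prefix_frequency_occ.
apply: linear_within_bound_cvg.
by have := ulin a (mem_enum _ a); rewrite big_enum /= f_sum divr1.
Qed.

Lemma ceil_log2 (R : realType) (d : nat) : (0 < d)%N ->
  exists2 k : nat, k%:Z = Num.ceil (log2 (d%:R : R)) & (d <= 2 ^ k)%N.
Proof.
move=> d_gt0.
have ln2_gt0 : 0 < ln 2 :> R by rewrite ln_gt0 // ltr1n.
have log_ge0 : 0 <= log2 (d%:R : R) by rewrite divr_ge0 ?ln_ge0 ?ler1n // ltW.
have ceil_ge0 : 0 <= Num.ceil (log2 (d%:R : R)) by rewrite -(ceil0 R) le_ceil.
exists `|Num.ceil (log2 (d%:R : R))|%N; first by rewrite gez0_abs.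
set k := `|_|%N.
have : log2 (d%:R : R) <= k%:R by rewrite natr_absz ger0_norm // ceil_ge.
rewrite /log2 ler_pdivrMr // mulr_natl -lnXn // ler_ln ?posrE ?ltr0n ?exprn_gt0 //.
by rewrite -natrX ler_nat.
Qed.

Unset Implicit Arguments.

Theorem theorem2 (R : realType) (d : nat) (hd : (0 < d)%N) :
  exists k : nat, is_BT R d k /\ k%:Z <= Num.ceil (log2 (d%:R : R)).
Proof.
have [k <- dk] := ceil_log2 R hd.
have k_ok : exists n, `[< ~ frequency_restrictive R d n >].
  by exists k; apply/asboolP/not_frequency_restrictive; rewrite hd.
case: (ex_minnP k_ok) => m /asboolP m_ok m_min.
exists m; split; first by split=> // j j_ok; apply/m_min/asboolP.
by rewrite lez_nat; apply/m_min/asboolP/not_frequency_restrictive; rewrite hd.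
Qed.
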